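(* Let $K\ge 3$, let $X_1,\dots,X_K$ be nonempty measurable spaces, $E=X_1\times\cdots\times X_K$, and let $c:E\to\mathbb R$ be a bounded measurable cost function. Let $\Gamma\subset E$ be a $c$-splitting set and let $(f_1,\dots,f_K)$, $f_k:X_k\to[-\infty,+\infty)$, be a splitting family for $\Gamma$, that is, $$\sum_{k=1}^K f_k(x_k)\le c(x_1,\dots,x_K)\quad\text{for all }(x_1,\dots,x_K)\in E,$$ $$\sum_{k=1}^K f_k(x_k)=c(x_1,\dots,x_K)\quad\text{for all }(x_1,\dots,x_K)\in\Gamma.$$ Then there exists another family $(g_1,\dots,g_K)$, $g_k:X_k\to[-\infty,+\infty)$, such that each $g_k$ is $c$-conjugate on $X_k$ and $(g_1,\dots,g_K)$ is still splitting for $\Gamma$, i.e. $$\sum_{k=1}^K g_k(x_k)\le c(x_1,\dots,x_K)\quad\text{for all }(x_1,\dots,x_K)\in E,$$ $$\sum_{k=1}^K g_k(x_k)=c(x_1,\dots,x_K)\quad\text{for all }(x_1,\dots,x_K)\in\Gamma.$$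
   Context: A set $\Gamma\subset E$ is a $c$-splitting set if there exist functions $f_k:X_k\to[-\infty,+\infty)$, $k=1,\dots,K$, such that $\sum_k f_k(x_k)\le c(x_1,\dots,x_K)$ on $E$ and $\sum_k f_k(x_k)=c(x_1,\dots,x_K)$ on $\Gamma$; such a family is called a splitting family for $\Gamma$. A function $g_k:X_k\to[-\infty,+\infty)$ is $c$-conjugate on $X_k$ if there exist functions $h_l:X_l\to[-\infty,+\infty)$, $l\ne k$, such that for all $x_k\in X_k$ $$g_k(x_k)=\inf_{(x_l)_{l\ne k}\in\prod_{l\ne k}X_l}\Big\{c(x_1,\dots,x_K)-\sum_{l\ne k}h_l(x_l)\Big\},$$ where the expression in braces is $+\infty$ when some $h_l(x_l)=-\infty$. *)

(* Defs.v *)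
From mathcomp Require Import all_boot all_order all_algebra.
From mathcomp Require Import all_classical all_reals all_analysis.

Set Implicit Arguments.
Unset Strict Implicit.
Unset Printing Implicit Defensive.

Import Order.TTheory GRing.Theory Num.Theory.
Import numFieldNormedType.Exports.

Local Open Scope classical_set_scope.
Local Open Scope ring_scope.
Local Open Scope ereal_scope.

(* Generators of the product sigma-algebra on a finite product of possibly
   different measurable spaces: the library only has binary products and tuples
   over a single space. *)
Definition coordinate_sets (K : nat) (d : 'I_K -> measure_display)
    (X : forall k : 'I_K, measurableType (d k)) : set (set (forall k, X k)) :=
  \bigcup_k preimage_set_system setT (fun x : forall k, X k => x k) measurable.
Arguments coordinate_sets {K d} X _.

(* [measurableType] extends [pointedType], so the factors are nonempty. *)
Definition prodE (K : nat) (d : 'I_K -> measure_display)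
    (X : forall k : 'I_K, measurableType (d k)) :=
  g_sigma_algebraType (coordinate_sets X).

Section splitting.
Context {R : realType} {K : nat} {d : 'I_K -> measure_display}.
Context {X : forall k : 'I_K, measurableType (d k)}.
Implicit Types (c : prodE X -> R) (G : set (prodE X)).

(* Functions into [-oo, +oo[ are [\bar R]-valued functions avoiding +oo; on
   such values [\bar R] addition never meets +oo + -oo. *)
Definition lt_pinfty (T : Type) (f : T -> \bar R) := forall x, f x < +oo.

Definition splitting_family c G (f : forall k, X k -> \bar R) : Prop :=
  [/\ forall k, lt_pinfty (f k),
      forall x : prodE X, \sum_(k < K) f k (x k) <= (c x)%:E
    & forall x : prodE X, G x -> \sum_(k < K) f k (x k) = (c x)%:E].

Definition splitting_set c G : Prop := exists f, splitting_family c G f.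

(* The infimum over (x_l)_{l <> k} is taken over the points of the product
   whose k-th coordinate is [t]; the component [h k] is never used. If some
   h_l(x_l) = -oo, the sum is -oo and the difference is +oo. *)
Definition c_conjugate c (k : 'I_K) (g : X k -> \bar R) : Prop :=
  lt_pinfty g /\
  exists h : forall l, X l -> \bar R,
    (forall l, l != k -> lt_pinfty (h l)) /\
    forall t : X k,
      g t = ereal_inf [set (c x)%:E - \sum_(l < K | l != k) h l (x l)
                      | x in [set x : prodE X | x k = t]].

End splitting.

(* Main.v *)
(** Improve the family one index at a time: replacing [g k] by the infimum of
    [c - \sum_(l != k) g l] can only increase it while keeping the sum below
    [c], hence keeps the equality on [Gamma]. Conjugacy of [g k] only asks for
    some conjugating functions, so it is not affected when the other members
    are replaced later. The infimum stays below [+oo] as long as no [g l] is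
    identically [-oo]; this is automatic unless [Gamma] is empty, in which case
    one starts from a constant family given by a lower bound of [c]. *)
Require Import Defs.
From HB Require Import structures.
From mathcomp Require Import all_boot all_order all_algebra.
From mathcomp Require Import all_classical all_reals all_analysis.

Import Order.TTheory GRing.Theory Num.Theory.
Import numFieldNormedType.Exports.

Local Open Scope classical_set_scope.
Local Open Scope ring_scope.

Section conjugation.
Set Implicit Arguments.
Unset Strict Implicit.
Local Open Scope ereal_scope.
Context {R : realType} {K : nat} {d : 'I_K -> measure_display}.
Context {X : forall k : 'I_K, measurableType (d k)}.
Implicit Types (c : prodE X -> R) (G : set (prodE X)).
Implicit Types (g : forall k, X k -> \bar R).

Definition conjugate c g (k : 'I_K) (t : X k) : \bar R :=
  ereal_inf [set (c x)%:E - \sum_(l < K | l != k) g l (x l)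
            | x in [set x : prodE X | x k = t]].
Arguments conjugate c g k t : clear implicits.

Definition proper g := forall k, exists z, g k z != -oo.

(** At a point of [G] the sum equals the finite value of [c], so no summand is [-oo] there. *)
Lemma proper_splitting_family c G g :
  G !=set0 -> splitting_family c G g -> proper g.
Proof.
move=> [x Gx] [_ _ eqc] k; exists (x k); apply/eqP => gk.
by have := eqc x Gx; rewrite (bigD1 k) //= gk addNye.
Qed.

Lemma proper_splitting_family_set0 c :
  (0 < K)%N -> [bounded c x | x in [set: prodE X]] ->
  exists2 g, splitting_family c set0 g & proper g.
Proof.
move=> K0 [M [_ cM]].
(* Only numbers strictly above [M] are known to bound [|c|], hence [M + 1]; the [K] equal constants
   add up to [- (M + 1)]. *)
exists (fun k _ => (- (M + 1) / K%:R)%:E); last by move=> k; exists point.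
split=> [k t|x|//]; first exact: ltry.
rewrite sumEFin sumr_const card_ord -[X in X%:E]mulr_natr divfK ?pnatr_eq0 -?lt0n//.
have : (`|c x| <= M + 1)%R by apply: cM => //; rewrite ltrDl ltr01.
by rewrite lee_fin ler_norml => /andP[].
Qed.

Lemma sum_lt_pinfty (I : finType) (P : pred I) (a : I -> \bar R) :
  (forall i, a i < +oo) -> \sum_(i | P i) a i < +oo.
Proof. by move=> alt; apply: lte_sum_pinfty => i _; exact: alt. Qed.

(** One competitor in the infimum suffices: [t] in coordinate [k], and elsewhere points where [g l]
    is not [-oo]. *)
Lemma conjugate_lt_pinfty c g k :
  (forall l, lt_pinfty (g l)) -> proper g -> lt_pinfty (conjugate c g k).
Proof.
move=> glt gp t; pose z l := projT1 (cid (gp l)).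
pose x : prodE X := dfwith z k t.
have xk : x k = t by rewrite /x dfwithin.
apply: (@le_lt_trans _ _ ((c x)%:E - \sum_(l < K | l != k) g l (x l))).
  by apply: ereal_inf_lbound; exists x.
have : \sum_(l < K | l != k) g l (x l) != -oo.
  apply/eqP => /eqP; rewrite esum_eqNy => /existsP[l /andP[lk]].
  by apply/negP; rewrite /x dfwithout 1?eq_sym // (projT2 (cid (gp l))).
by case: (\sum_(l < K | l != k) g l (x l)) => [r||] //= _; rewrite ltry.
Qed.

Lemma le_conjugate c G g k t :
  splitting_family c G g -> g k t <= conjugate c g k t.
Proof.
move=> [glt gle _]; apply: le_ereal_inf_tmp => _ [x /= <- <-].
have := gle x; rewrite (bigD1 k) //=.
have : \sum_(l < K | l != k) g l (x l) < +oo.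
  by apply: sum_lt_pinfty => l; exact: glt.
case: (\sum_(l < K | l != k) g l (x l)) => [r _|//|_ _].
  by rewrite leeBrDr.
by rewrite /= leey.
Qed.

Lemma conjugate_sum_le c g k (x : prodE X) :
  (forall l, lt_pinfty (g l)) ->
  conjugate c g k (x k) + \sum_(l < K | l != k) g l (x l) <= (c x)%:E.
Proof.
move=> glt.
have : conjugate c g k (x k) <= (c x)%:E - \sum_(l < K | l != k) g l (x l).
  by apply: ereal_inf_lbound; exists x.
have : \sum_(l < K | l != k) g l (x l) < +oo.
  by apply: sum_lt_pinfty => l; exact: glt.
case: (\sum_(l < K | l != k) g l (x l)) => [r _|//|_ _].
  by rewrite leeBrDr.
(* Here the conjugate may be [+oo], but adding [-oo] gives [-oo] in any case. *)
by rewrite addeNy leNye.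
Qed.

Lemma sum_dfwith g k (u : X k -> \bar R) (x : prodE X) :
  \sum_(l < K) dfwith g k u l (x l) =
  u (x k) + \sum_(l < K | l != k) g l (x l).
Proof.
rewrite (bigD1 k) //= dfwithin; congr (_ + _).
by apply: eq_bigr => l lk; rewrite dfwithout // eq_sym.
Qed.

(** The new sum lies between the old one and [c], which coincide on [G]; properness survives because
    components only increase. *)
Lemma splitting_family_conjugate c G g k :
  splitting_family c G g -> proper g ->
  splitting_family c G (dfwith g k (conjugate c g k)) /\
  proper (dfwith g k (conjugate c g k)).
Proof.
move=> gG gp; have [glt gle geq] := gG.
have le_g l t : g l t <= dfwith g k (conjugate c g k) l t.
  by case: dfwithP t => // t; exact: le_conjugate gG.
have le_c (x : prodE X) :
    \sum_(l < K) dfwith g k (conjugate c g k) l (x l) <= (c x)%:E.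
  by rewrite sum_dfwith conjugate_sum_le.
split; last first.
  move=> l; have [z gz] := gp l; exists z.
  by rewrite -ltNye (lt_le_trans _ (le_g l z)) // ltNye.
split=> // [l|x Gx].
  by case: dfwithP => [|j _]; [exact: conjugate_lt_pinfty|exact: glt].
by apply/le_anti; rewrite le_c -(geq x Gx); apply: lee_sum => l _; exact: le_g.
Qed.

Lemma c_conjugate_conjugate c g k :
  (forall l, lt_pinfty (g l)) -> proper g -> c_conjugate c (conjugate c g k).
Proof. by move=> glt gp; split; [exact: conjugate_lt_pinfty|exists g; split]. Qed.

Lemma exists_conjugate_splitting_family c G g :
  splitting_family c G g -> proper g ->
  exists g', (forall k, c_conjugate c (g' k)) /\ splitting_family c G g'.
Proof.
move=> gG gp.
(* Stated for a list of indices already treated, so that induction applies; properness is carried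
   along since the next conjugation needs it. *)
suff [g' [g'c g'G _]] : exists g', [/\ {in enum 'I_K, forall k, c_conjugate c (g' k)},
    splitting_family c G g' & proper g'].
  by exists g'; split=> // k; apply: g'c; rewrite mem_enum.
elim: (enum 'I_K) => [|k s [g1 [g1c g1G g1p]]]; first by exists g.
have [g2G g2p] := splitting_family_conjugate k g1G g1p.
exists (dfwith g1 k (conjugate c g1 k)); split=> // j.
case: dfwithP => [_|l kl]; first by apply: c_conjugate_conjugate; case: g1G.
by rewrite inE eq_sym (negbTE kl) => /g1c.
Qed.

End conjugation.

Theorem proposition1 (R : realType) (K : nat) (hK : (3 <= K)%N)
    (d : 'I_K -> measure_display)
    (X : forall k : 'I_K, measurableType (d k))
    (c : prodE X -> R)
    (c_meas : measurable_fun [set: prodE X] c)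
    (c_bounded : [bounded c x | x in [set: prodE X]])
    (Gamma : set (prodE X))
    (Gamma_split : splitting_set c Gamma)
    (f : forall k : 'I_K, X k -> \bar R)
    (f_split : splitting_family c Gamma f) :
  exists g : forall k : 'I_K, X k -> \bar R,
    (forall k : 'I_K, c_conjugate c (g k)) /\ splitting_family c Gamma g.
Proof.
(* For empty [Gamma], [f] may have a component identically [-oo], so it is replaced by a proper
   family. *)
have [Gamma0|Gamma_neq0] := eqVneq Gamma set0.
  have [g gG gp] := proper_splitting_family_set0 (ltnW (ltnW hK)) c_bounded.
  by rewrite Gamma0; exact: exists_conjugate_splitting_family gG gp.
apply: (exists_conjugate_splitting_family f_split).
by apply: proper_splitting_family f_split; exact/set0P.
Qed.
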